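(* The kernel $\mathcal K$ is a right group if and only if $u_2(I)$ takes only the values $0$ and $1$ as $I$ runs through the two-element subsets of the vertex set.
   Context: The setting: a directed graph on the vertex set $\{1,\ldots,n\}$ in which each vertex has out-degree $d$, with adjacency matrix $\mathcal A$ such that $A=d^{-1}\mathcal A$ is irreducible and aperiodic; $\mathcal A=C_1+\cdots+C_d$, where each $C_i$ is a binary stochastic matrix (a $0$-$1$ matrix with exactly one $1$ in each row). $\mathcal S$ is the finite semigroup generated by the $C_i$ under matrix multiplication, and $\mathcal K$ is its kernel (minimal ideal, consisting of the elements of minimal rank). The partition of $k\in\mathcal K$ is the partition of the vertices into the nonempty blocks $\{i:k_{ij}=1\}$. $\mathcal K$ is a right group if, in its Rees product decomposition $\mathcal X\times\mathcal G\times\mathcal Y$ ($\mathcal X$ identified with the set of partitions, $\mathcal Y$ with the set of ranges), $\mathcal X$ is a single point; equivalently, all elements of $\mathcal K$ have the same partition. Each binary stochastic matrix $F$ corresponds to the function $f$ with $F_{ij}=1$ iff $f(i)=j$; $F^{(2)}$ is the matrix indexed by two-element subsets $I,J$ of the vertex set with $F^{(2)}_{IJ}=1$ if $f(I)=J$ and $0$ otherwise. Let $A_2=\frac1d\sum_iC_i^{(2)}$ and $\Omega_2=\lim_{N\to\infty}\frac1N\sum_{m=1}^NA_2^m$ (which exists). The vector $u_2$, indexed by two-element subsets, is the vector of row sums of $\Omega_2$: $u_2(I)=\sum_J(\Omega_2)_{IJ}$. *)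

(* Defs.v *)
From HB Require Import structures.
From mathcomp Require Import all_boot all_order all_algebra all_fingroup.
From mathcomp Require Import all_classical all_reals all_analysis.

Set Implicit Arguments.
Unset Strict Implicit.
Unset Printing Implicit Defensive.

Import Order.TTheory GRing.Theory Num.Theory.
Import numFieldNormedType.Exports.

Local Open Scope classical_set_scope.
Local Open Scope ring_scope.

Definition irreducible_mx (R : realType) (n : nat) (A : 'M[R]_n) : Prop :=
  forall i j : 'I_n, exists m : nat, (0 < m)%N /\ 0 < (A ^+ m) i j.

(* The gcd of the lengths of the closed walks through each vertex is 1. *)
Definition aperiodic_mx (R : realType) (n : nat) (A : 'M[R]_n) : Prop :=
  forall (i : 'I_n) (g : nat),
    (forall m : nat, (0 < m)%N -> 0 < (A ^+ m) i i -> (g %| m)%N) -> g = 1%N.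

Definition binary_stochastic (R : realType) (n : nat) (F : 'M[R]_n) : Prop :=
  (forall i j : 'I_n, F i j = 0 \/ F i j = 1) /\
  (forall i : 'I_n, exists! j : 'I_n, F i j = 1).

(* For F binary stochastic, the f with F i j = 1 iff f i = j; the default value
   i of [odflt] is then never used. *)
Definition fun_of_mx (R : realType) (n : nat) (F : 'M[R]_n) (i : 'I_n) : 'I_n :=
  odflt i [pick j | F i j == 1].

Inductive gen_semigroup (R : realType) (n d : nat) (C : 'I_d -> 'M[R]_n) :
    set 'M[R]_n :=
| gen_semigroup_base : forall i : 'I_d, gen_semigroup C (C i)
| gen_semigroup_mul : forall F G : 'M[R]_n,
    gen_semigroup C F -> gen_semigroup C G -> gen_semigroup C (F *m G).

Definition semigroup_ideal (R : realType) (n : nat) (S I : set 'M[R]_n) : Prop :=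
  [/\ I !=set0, I `<=` S &
      forall s x : 'M[R]_n, S s -> I x -> I (s *m x) /\ I (x *m s)].

(* The least ideal, written as the intersection of all ideals; it is itself an
   ideal when S is a nonempty finite semigroup. *)
Definition kernel_ideal (R : realType) (n : nat) (S : set 'M[R]_n) :
    set 'M[R]_n :=
  \bigcap_(I in [set I | semigroup_ideal S I]) I.

Definition mx_partition (R : realType) (n : nat) (k : 'M[R]_n) :
    {set {set 'I_n}} :=
  ([set [set i | k i j == 1] | j : 'I_n] :\ finset.set0)%SET.

Definition mx_range (R : realType) (n : nat) (k : 'M[R]_n) : {set 'I_n} :=
  [set j | [exists i, k i j == 1]]%SET.

Definition rees_mul (X Y : Type) (gT : finGroupType) (phi : Y -> X -> gT)
    (a b : X * gT * Y) : X * gT * Y :=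
  (a.1.1, (a.1.2 * phi a.2 b.1.1 * b.1.2)%g, b.2).

(* theta is an isomorphism of K onto a Rees product X x G x Y with sandwich
   function phi : Y x X -> G, where X is the set of partitions and Y the set of
   ranges of the elements of K. *)
Definition rees_decomposition (R : realType) (n : nat) (K : set 'M[R]_n)
    (gT : finGroupType) (phi : {set 'I_n} -> {set {set 'I_n}} -> gT)
    (theta : 'M[R]_n -> {set {set 'I_n}} * gT * {set 'I_n}) : Prop :=
  [/\ set_bij K
        ((@mx_partition R n @` K) `*` [set: gT] `*` (@mx_range R n @` K)) theta,
      forall k, K k ->
        (theta k).1.1 = mx_partition k /\ (theta k).2 = mx_range k &
      forall k l, K k -> K l -> theta (k *m l) = rees_mul phi (theta k) (theta l)].

Definition right_group (R : realType) (n : nat) (K : set 'M[R]_n) : Prop :=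
  exists (gT : finGroupType) (phi : {set 'I_n} -> {set {set 'I_n}} -> gT)
         (theta : 'M[R]_n -> {set {set 'I_n}} * gT * {set 'I_n}),
    rees_decomposition K phi theta /\
    exists P : {set {set 'I_n}}, @mx_partition R n @` K = [set P].

Definition pairs (n : nat) : {set {set 'I_n}} :=
  [set I : {set 'I_n} | #|I| == 2%N]%SET.

(* Rows and columns are numbered by 'I_#|pairs n|; the index I stands for the
   two-element subset [enum_val I]. If f is not injective on that subset, its
   row is 0. *)
Definition pair_mx (R : realType) (n : nat) (F : 'M[R]_n) : 'M[R]_#|pairs n| :=
  \matrix_(I < #|pairs n|, J < #|pairs n|)
    ((fun_of_mx F @: (enum_val I : {set 'I_n}))%SET == enum_val J)%:R.

Definition A2 (R : realType) (n d : nat) (C : 'I_d -> 'M[R]_n) :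
    'M[R]_#|pairs n| :=
  d%:R^-1 *: \sum_(i < d) pair_mx (C i).

(* Entrywise Cesaro limit. *)
Definition Omega2 (R : realType) (n d : nat) (C : 'I_d -> 'M[R]_n) :
    'M[R]_#|pairs n| :=
  \matrix_(I, J)
    limn (fun N : nat => N%:R^-1 * \sum_(1 <= m < N.+1) (A2 C ^+ m) I J).

Definition u2 (R : realType) (n d : nat) (C : 'I_d -> 'M[R]_n) :
    'cV[R]_#|pairs n| :=
  \col_I \sum_J Omega2 C I J.

(* Main.v *)
Require Import Defs.
From HB Require Import structures.
From mathcomp Require Import all_boot all_order all_algebra all_fingroup.
From mathcomp Require Import all_classical all_reals all_analysis.

Set Implicit Arguments.
Unset Strict Implicit.
Unset Printing Implicit Defensive.

Import Order.TTheory GRing.Theory Num.Theory.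
Import numFieldNormedType.Exports.

Local Open Scope classical_set_scope.
Local Open Scope ring_scope.

(** Read a binary stochastic matrix as a map of the vertex set, so that products
of the matrices become compositions, performed from left to right.  The kernel
of a nonempty transformation semigroup consists of its maps of minimal rank
(kernel_ideal_fun), and composing such a map with another element before or
after it stays in the kernel.  A kernel element is therefore injective on the
image of any other one, and the Rees structure reduces to a statement about
fibres: the kernel is a right group exactly when two points identified by one
kernel element are identified by all of them (right_group_fun).

On the other side, read u2 as a function U of two points, with U x x = 0.  The
matrix A2 averages over the d generators, so A2 Omega2 = Omega2 says that U is
harmonic for the random walk that applies a random generator to both points
(u2_harmonic).  It takes values in [0, 1], and it equals 1 at a pair that no
word collapses, since there the row sums of all the powers of A2 are 1
(u2_uncollapsed).  The existence of the Cesaro limit Omega2 and its invariance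
come from the mean ergodic theorem for power-bounded matrices (mean_ergodic).

The equivalence now follows from the maximum principle (max_principle).  Suppose
all kernel elements have the same fibres.  The pairs inside a fibre form a class
that the walk does not leave, and U vanishes on it: the maximum of U on the
class would be attained along every walk, yet a kernel word ends on the
diagonal.  A pair that meets two fibres is collapsed by no word, so U = 1 there.
Conversely, suppose that a kernel element k collapses x and y but another kernel
element l does not.  Then U x y < 1 by the maximum principle for U, as k leads
to the diagonal.  Also U x y > 0 by the maximum principle for 1 - U, as l leads
to a pair on which every word is injective.  So U x y is neither 0 nor 1. *)

(** * Maps of minimal rank in a transformation semigroup *)

Definition comp_closed (T : Type) (S : set (T -> T)) : Prop :=
  forall f g, S f -> S g -> S (g \o f).

Definition min_rank (T : finType) (S : set (T -> T)) : set (T -> T) :=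
  [set f | S f /\ forall g, S g -> (#|codom f| <= #|codom g|)%N].

Lemma ex_min_rank (T : finType) (S : set (T -> T)) :
  S !=set0 -> min_rank S !=set0.
Proof.
case=> f0 Sf0.
have ex : exists m, `[< exists2 f, S f & #|codom f| = m >].
  by exists #|codom f0|; apply/asboolP; exists f0.
case: (ex_minnP ex) => m /asboolP[f Sf fm] min_m; exists f; split=> // g Sg.
by rewrite fm; apply: min_m; apply/asboolP; exists g.
Qed.

Lemma card_codom_comp (T : finType) (f g : T -> T) :
  #|codom (g \o f)| = #|fintype.image g (codom f)|.
Proof.
apply: eq_card => y; apply/codomP/fintype.imageP => [[x ->]|[z /codomP[x ->] ->]].
  by exists (f x); first exact: codom_f.
by exists x.
Qed.

Lemma codom_comp_sub (T : finType) (f g : T -> T) :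
  codom (g \o f) \subset codom g.
Proof. by apply/fintype.subsetP => y /codomP[x ->]; exact: (codom_f g). Qed.

Lemma min_rank_compl (T : finType) (S : set (T -> T)) (f g : T -> T) :
  comp_closed S -> min_rank S f -> S g -> min_rank S (g \o f).
Proof.
move=> cS [Sf mf] Sg; split; first exact: cS.
by move=> h /mf; apply: leq_trans; rewrite card_codom_comp leq_image_card.
Qed.

Lemma min_rank_compr (T : finType) (S : set (T -> T)) (f g : T -> T) :
  comp_closed S -> S f -> min_rank S g -> min_rank S (g \o f).
Proof.
move=> cS Sf [Sg mg]; split; first exact: cS.
move=> h /mg; apply: leq_trans; apply: subset_leq_card.
exact: codom_comp_sub.
Qed.

(** Composing with [g] cannot lower the rank of [f] any further, so [g] is
injective on the image of [f]. *)
Lemma min_rank_inj (T : finType) (S : set (T -> T)) (f g : T -> T) :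
  comp_closed S -> min_rank S f -> S g -> forall x y, g (f x) = g (f y) -> f x = f y.
Proof.
move=> cS [Sf mf] Sg x y.
have /image_injP inj : #|fintype.image g (codom f)| == #|codom f|.
  by rewrite eqn_leq leq_image_card -card_codom_comp mf //; exact: cS.
by apply: inj; exact: codom_f.
Qed.

Lemma min_rank_codom (T : finType) (S : set (T -> T)) (f g : T -> T) :
  comp_closed S -> S f -> min_rank S g -> codom (g \o f) =i codom g.
Proof.
move=> cS Sf [Sg mg]; apply/subset_cardP; last exact: codom_comp_sub.
apply/eqP; rewrite eqn_leq (subset_leq_card (codom_comp_sub f g)) mg //.
exact: cS.
Qed.

Lemma extend_perm (T : finType) (A : {pred T}) (h : T -> T) :
  {in A, forall x, h x \in A} -> {in A &, injective h} ->
  exists p : {perm T}, forall x, p x = if x \in A then h x else x.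
Proof.
move=> hA hI; pose q x := if x \in A then h x else x.
have qI : injective q.
  move=> x y; rewrite /q; case: ifPn => xA; case: ifPn => yA //; first exact: hI.
    by move=> E; rewrite -E hA in yA.
  by move=> E; rewrite E hA in xA.
by exists (perm qI) => x; rewrite permE.
Qed.

(** On [A] the map is a permutation, hence of finite order. *)
Lemma iter_id_on (T : finType) (A : {pred T}) (h : T -> T) :
  {in A, forall x, h x \in A} -> {in A &, injective h} ->
  exists m, {in A, forall x, iter m.+1 h x = x}.
Proof.
move=> hA hI; have [p pE] := extend_perm hA hI.
exists #[p]%g.-1; rewrite prednK ?order_gt0 // => x xA.
rewrite -[RHS](perm1 x) -(expg_order p) permX.
suff : forall m, iter m h x = iter m p x /\ iter m h x \in A by move=> /(_ #[p]%g)[].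
by elim=> [//|m [E IA]]; rewrite !iterS -E pE IA hA.
Qed.

Lemma iter_closed (T : Type) (S : set (T -> T)) (f : T -> T) m :
  comp_closed S -> S f -> S (iter m.+1 f).
Proof.
move=> cS Sf; elim: m => [//|m IH].
by apply: (cS (iter m.+1 f) f).
Qed.

(** The idempotent is a power of [f]: [f] permutes its own image by minimality of
the rank, so some power of it fixes that image pointwise. *)
Lemma min_rank_idem (T : finType) (S : set (T -> T)) (f : T -> T) :
  comp_closed S -> min_rank S f ->
  exists e, [/\ min_rank S e, codom e =i codom f &
                {in codom f, forall x, e x = x}].
Proof.
move=> cS mf; have [Sf _] := mf.
have [||m mE] := @iter_id_on T (mem (codom f)) f.
- by move=> x _; exact: codom_f.
- by move=> _ _ /codomP[x ->] /codomP[y ->]; exact: min_rank_inj mf Sf _ _.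
exists (iter m.+1 f).
have codomE : codom (iter m.+1 f) =i codom f.
  move=> y; apply/codomP/idP => [[x ->]|yf]; first by rewrite iterS codom_f.
  by exists y; rewrite mE.
split=> //; split; first exact: iter_closed.
by move=> g /(mf.2); rewrite (eq_card codomE).
Qed.

(** * Matrices of maps, and the kernel as a Rees product *)

Definition fun_mx (R : realType) (n : nat) (f : 'I_n -> 'I_n) : 'M[R]_n :=
  \matrix_(i, j) (f i == j)%:R.

Lemma fun_mxM (R : realType) (n : nat) (f g : 'I_n -> 'I_n) :
  fun_mx R f *m fun_mx R g = fun_mx R (g \o f).
Proof.
apply/matrixP => i j; rewrite !mxE (bigD1 (f i)) //= !mxE eqxx mul1r.
rewrite big1 ?addr0 // => k kf.
by rewrite !mxE eq_sym (negPf kf) mul0r.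
Qed.

Lemma fun_mx_eq1 (R : realType) (n : nat) (f : 'I_n -> 'I_n) i j :
  (fun_mx R f i j == 1) = (f i == j).
Proof. by rewrite mxE; case: (f i == j); rewrite ?eqxx // eq_sym oner_eq0. Qed.

Lemma fun_mxK (R : realType) (n : nat) (f : 'I_n -> 'I_n) :
  fun_of_mx (fun_mx R f) = f.
Proof.
apply/funext => i; rewrite /fun_of_mx; case: pickP => /= [j|/(_ (f i))].
  by rewrite fun_mx_eq1 => /eqP.
by rewrite fun_mx_eq1 eqxx.
Qed.

Lemma binary_stochasticE (R : realType) (n : nat) (F : 'M[R]_n) :
  binary_stochastic F -> F = fun_mx R (fun_of_mx F).
Proof.
case=> F01 F1; apply/matrixP => i j; rewrite mxE.
have [k [Fk uk]] := F1 i.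
have -> : fun_of_mx F i = k.
  rewrite /fun_of_mx; case: pickP => /= [l /eqP/uk-> //|/(_ k)].
  by rewrite Fk eqxx.
case: eqP => [<-//|kj]; case: (F01 i j) => // /uk.
by [].
Qed.

Lemma in_mx_range (R : realType) (n : nat) (f : 'I_n -> 'I_n) (y : 'I_n) :
  (y \in mx_range (fun_mx R f)) = (y \in codom f).
Proof.
rewrite inE; apply/existsP/codomP => [[x]|[x ->]].
  by rewrite fun_mx_eq1 => /eqP<-; exists x.
by exists x; rewrite fun_mx_eq1.
Qed.

Lemma mx_partition_fun (R : realType) (n : nat) (f : 'I_n -> 'I_n) :
  mx_partition (fun_mx R f) = [set [set y | f y == f x] | x : 'I_n]%SET.
Proof.
apply/setP => B; rewrite !inE; apply/andP/imsetP => [[B0 /imsetP[j _ Bj]]|[x _ ->]].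
  case/set0Pn: B0 => x; rewrite Bj inE fun_mx_eq1 => /eqP fx.
  by exists x => //; apply/setP => y; rewrite !inE fun_mx_eq1 fx.
split; first by apply/set0Pn; exists x; rewrite inE.
by apply/imsetP; exists (f x) => //; apply/setP => y; rewrite !inE fun_mx_eq1.
Qed.

(** Partitions of kernel elements are compared below only through this
characterization: equal partitions mean the same pairs are identified. *)
Lemma mx_partition_eqP (R : realType) (n : nat) (f g : 'I_n -> 'I_n) :
  mx_partition (fun_mx R f) = mx_partition (fun_mx R g) <->
  forall x y, (f x == f y) = (g x == g y).
Proof.
rewrite !mx_partition_fun; split=> [E x y|E]; last first.
  by apply: eq_imset => x; apply/setP => y; rewrite !inE E.
have : [set z | f z == f y]%SET \in [set [set y | g y == g x] | x : 'I_n]%SET.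
  by rewrite -E; apply/imsetP; exists y.
case/imsetP => z _ /setP H.
have := H y; rewrite !inE eqxx => /esym/eqP ->.
by have := H x; rewrite !inE.
Qed.

(** The maps of minimal rank form an ideal, and they lie in every ideal [I]: if [t]
has minimal rank and [I] contains [g], then [t \o g] permutes the image of [t],
so [t] equals [iter m.+1 (t \o g) \o t] for some [m], which is in [I]. *)
Lemma kernel_ideal_fun (R : realType) (n : nat) (S : set ('I_n -> 'I_n)) :
  S !=set0 -> comp_closed S ->
  kernel_ideal (@fun_mx R n @` S) = @fun_mx R n @` min_rank S.
Proof.
move=> S0 cS; apply/seteqP; split=> F.
  apply; split=> /=.
  - by have [f mf] := ex_min_rank S0; exists (fun_mx R f); exists f.
  - by move=> _ [f [Sf _] <-]; exists f.
  move=> _ _ [f Sf <-] [g mg <-]; rewrite !fun_mxM; split.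
    by exists (g \o f) => //; exact: min_rank_compr.
  by exists (f \o g) => //; exact: min_rank_compl.
case=> t mt <- I [[x Ix] IS Iid]; have [g Sg gx] := IS x Ix; have [St _] := mt.
have mh : min_rank S (t \o g) by exact: min_rank_compr.
have Sh : S (t \o g) by case: mh.
have [||m mE] := @iter_id_on _ (mem (codom t)) (t \o g).
- by move=> z _; exact: codom_f.
- by move=> _ _ /codomP[a ->] /codomP[b ->]; exact: min_rank_inj mt Sh _ _.
suff : I (fun_mx R (iter m.+1 (t \o g) \o t)).
  suff -> : iter m.+1 (t \o g) \o t = t by [].
  by apply/funext => z; apply: mE; exact: codom_f.
have It : I (fun_mx R ((t \o g) \o t)).
  rewrite -fun_mxM -(fun_mxM _ g t) gx.
  apply: (Iid (fun_mx R t) _ _ _).1; first by exists t.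
  by apply: (Iid (fun_mx R t) _ _ _).2 => //; exists t.
elim: m {mE} => [//|m IH].
have -> : iter m.+2 (t \o g) \o t = (t \o g) \o (iter m.+1 (t \o g) \o t) by [].
rewrite -fun_mxM; apply: (Iid (fun_mx R (t \o g)) _ _ _).2 => //.
Qed.

(** When all maps of minimal rank have the same fibres, choose an idempotent [e]
among them.  The group of the Rees product consists of the permutations that
the maps [e \o f] induce on the image of [e], extended by the identity; the
sandwich function is constantly 1 because [f \o e = f] for all [f] of minimal
rank ([idl] below).  A map [f] is recovered from [e \o f] and its range by
means of an idempotent [h] with that range. *)
Lemma right_group_fun (R : realType) (n : nat) (S : set ('I_n -> 'I_n)) :
  S !=set0 -> comp_closed S ->
  right_group (@fun_mx R n @` min_rank S) <->
  (forall f g, min_rank S f -> min_rank S g ->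
     forall x y, f x = f y -> g x = g y).
Proof.
move=> S0 cS; split.
  move=> [gT [phi [theta [_ [P /seteqP[EP _]]]]]] f g mf mg x y /eqP fxy.
  have P1 h : min_rank S h -> mx_partition (fun_mx R h) = P.
    by move=> mh; apply: EP; exists (fun_mx R h) => //; exists h.
  have /mx_partition_eqP E : mx_partition (fun_mx R f) = mx_partition (fun_mx R g).
    by rewrite !P1.
  by apply/eqP; rewrite -E.
move=> ker.
have [f0 mf0] := ex_min_rank S0.
have [e [me cEe0 eid0]] := min_rank_idem cS mf0.
have eid : {in codom e, forall x, e x = x} by move=> x; rewrite cEe0 => /eid0.
have [Se _] := me.
have idl f : min_rank S f -> forall x, f (e x) = f x.
  by move=> mf x; apply: (ker e f me mf); rewrite eid ?codom_f.
pose isp (F : 'M[R]_n) (s : {perm 'I_n}) :=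
  [forall x, s x == if x \in codom e then e (fun_of_mx F x) else x].
pose p (F : 'M[R]_n) : {perm 'I_n} := odflt 1%g [pick s | isp F s].
have pE f : min_rank S f ->
    forall x, p (fun_mx R f) x = if x \in codom e then e (f x) else x.
  move=> mf; have mef : min_rank S (e \o f) by apply: min_rank_compl.
  have [||s sE] := @extend_perm _ (mem (codom e)) (e \o f).
  - by move=> x _; exact: codom_f.
  - move=> x y xe ye /(ker (e \o f) e mef me).
    by rewrite !eid.
  rewrite /p; case: pickP => /= [t /forallP tE x|/(_ s)].
    by rewrite (eqP (tE x)) fun_mxK.
  by case/forallP => x; rewrite fun_mxK sE.
pose H : {set {perm 'I_n}} :=
  [set s | `[< exists2 f, min_rank S f & s = p (fun_mx R f) >]]%SET.
(* Products in {perm _} are composed from left to right, as those of matrices. *)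
have pM f g : min_rank S f -> min_rank S g ->
    p (fun_mx R (g \o f)) = (p (fun_mx R f) * p (fun_mx R g))%g.
  move=> mf mg; have [Sf _] := mf.
  apply/permP => x; rewrite permM !pE //; last exact: min_rank_compr.
  case: ifP => xe; last by rewrite xe.
  by rewrite codom_f /= idl.
have gH : group_set H.
  apply/group_setP; split=> [|s t].
    rewrite inE; apply/asboolP; exists e => //.
    apply/permP => x; rewrite perm1 pE //.
    by case: ifP => // xe; rewrite !eid.
  rewrite !inE => -[f mf sf] [g mg tg].
  exists (g \o f); last by rewrite sf tg pM.
  by apply: min_rank_compr => //; case: mf.
have inH f : min_rank S f -> p (fun_mx R f) \in Group gH.
  by move=> mf; rewrite inE; apply/asboolP; exists f.
pose theta (F : 'M[R]_n) := (mx_partition F, subg (Group gH) (p F), mx_range F).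
exists (subg_of (Group gH)), (fun _ _ => 1%g), theta.
have Peq f g : min_rank S f -> min_rank S g ->
    mx_partition (fun_mx R f) = mx_partition (fun_mx R g).
  move=> mf mg; apply/mx_partition_eqP => x y.
  by apply/eqP/eqP; apply: ker.
split; last first.
  exists (mx_partition (fun_mx R e)); apply/seteqP; split=> [_ [_ [f mf <-] <-]|P ->].
    exact: Peq.
  by exists (fun_mx R e) => //; exists e.
split.
- split.
  + by move=> _ [f mf <-]; split; [split|] => //=; exists (fun_mx R f) => //; exists f.
  + move=> _ _ /set_mem[f mf <-] /set_mem[g mg <-] [_ Ep Er].
    have {}Ep : p (fun_mx R f) = p (fun_mx R g).
      by move/(congr1 sgval): Ep; rewrite !subgK ?inH.
    have cE : codom f =i codom g.
      by move=> y; rewrite -(in_mx_range R) Er in_mx_range.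
    (* [h] is the identity on the common range and has the fibres of [e]. *)
    have [h [mh ch hid]] := min_rank_idem cS mf.
    congr fun_mx; apply/funext => x.
    have efg : e (f x) = e (g x).
      move/permP/(_ (e x)): Ep; rewrite !pE // codom_f.
      by rewrite !idl.
    rewrite -(hid (f x)) ?codom_f // -(hid (g x)) ?cE ?codom_f //.
    exact: ker me mh _ _ efg.
  + move=> [[P s] Y] /= [[[_ [f mf <-] <-] _] [_ [g mg <-] <-]].
    have := subgP s; rewrite inE => /asboolP[k mk sk].
    have [h [mh ch hid]] := min_rank_idem cS mg.
    have [Sk _] := mk.
    have mhk : min_rank S (h \o k) by apply: min_rank_compr.
    (* [k] has group component [s]; composing with [h] adjusts the range only. *)
    exists (fun_mx R (h \o k)); first by exists (h \o k).
    congr (_, _, _); first exact: Peq.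
      rewrite -[s]sgvalK; congr subg; rewrite sk; apply/permP => x; rewrite !pE //.
      case: ifP => // _ /=; apply: (ker h e mh me).
      by rewrite hid // -ch codom_f.
    apply/setP => y; rewrite !in_mx_range -ch.
    exact: (min_rank_codom cS Sk mh).
- by [].
move=> _ _ [f mf <-] [g mg <-]; rewrite fun_mxM /theta /rees_mul /=.
have [Sf _] := mf.
congr (_, _, _).
- by apply: Peq => //; exact: min_rank_compr.
- by rewrite pM // mulg1 subgM ?inH.
- by apply/setP => y; rewrite !in_mx_range; exact: (min_rank_codom cS Sf mg).
Qed.
(** * The mean ergodic theorem for power-bounded matrices *)

Lemma cvg_mean0 (R : realType) (b : R^nat) (B : R) :
  (forall m, `|b m| <= B) -> (fun m => m%:R^-1 * b m) @ \oo --> (0 : R).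
Proof.
move=> bB; apply: norm_cvg0; rewrite -cvg_shiftS.
have hB : (fun m => @harmonic R m * B) @ \oo --> 0 * B.
  by apply: cvgM; [exact: cvg_harmonic | exact: cvg_cst].
rewrite mul0r in hB.
apply: (@squeeze_cvgr _ _ _ _ (cst 0) (fun m => @harmonic R m * B)) => //;
  last exact: cvg_cst.
apply: nearW => m /=.
by rewrite normr_ge0 normrM ger0_norm ?invr_ge0 // ler_wpM2l ?invr_ge0.
Qed.

Lemma mulmx_bounded (R : realType) (p q r : nat) (A : 'M[R]_(p, q))
    (B : nat -> 'M[R]_(q, r)) (c : R) i k :
  (forall m j, `|B m j k| <= c) ->
  exists c', forall m, `|(A *m B m) i k| <= c'.
Proof.
move=> Bc; exists (\sum_j `|A i j| * c) => m; rewrite mxE.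
apply: le_trans (ler_norm_sum _ _ _) _; apply: ler_sum => j _.
by rewrite normrM ler_wpM2l.
Qed.

(** If [v = w *m (A - 1)] is fixed by [A], then [w *m A ^+ m = w + v *+ m]; this is
bounded in [m] only if [v = 0]. *)
Lemma ker_cap_image0 (R : realType) (p : nat) (A : 'M[R]_p) (c : R) :
  (forall m i j, `|(A ^+ m) i j| <= c) ->
  forall q (v w : 'M[R]_(q, p)), v *m A = v -> v = w *m (A - 1) -> v = 0.
Proof.
move=> Ac q v w vA vw; apply/matrixP => i j; rewrite [RHS]mxE.
have wA m : w *m A ^+ m = w + v *+ m.
  elim: m => [|m IH]; first by rewrite expr0 mulmx1 mulr0n addr0.
  have vwA : w *m A = w + v by rewrite vw mulmxBr mulmx1 addrC subrK.
  have vmA : (v *+ m) *m A = v *+ m by rewrite -scaler_nat -scalemxAl vA.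
  by rewrite exprSr mulmxA IH mulmxDl vwA vmA mulrS addrA.
have [b wb] := mulmx_bounded w i (fun m k => Ac m k j).
apply/eqP; rewrite -normr_le0 leNgt; apply/negP => v0.
have vb m : `|v i j| *+ m <= b + `|w i j|.
  have -> : `|v i j| *+ m = `|(w *m A ^+ m) i j - w i j|.
    by rewrite wA -[v *+ m]scaler_nat !mxE addrAC subrr add0r mulr_natl normrMn.
  by rewrite (le_trans (ler_normB _ _)) // lerD2r.
have := vb (Num.bound ((b + `|w i j|) / `|v i j|)).
by rewrite -mulr_natl leNgt -ltr_pdivrMr // unstable.ltr_bound.
Qed.

(** The kernel and the image of [A - 1] meet trivially, so by dimension they span
and [1 = Y + W *m (A - 1)] with [Y *m A = Y].  Multiplied by [A ^+ m] and summed
over [m], the second term telescopes to a bounded one and vanishes in the mean. *)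
Lemma mean_ergodic (R : realType) (p : nat) (A : 'M[R]_p) (c : R) :
  (forall m i j, `|(A ^+ m) i j| <= c) ->
  exists Y : 'M[R]_p, A *m Y = Y /\ forall q (v : 'M[R]_(p, q)) i j,
    (fun N : nat => N%:R^-1 * \sum_(1 <= m < N.+1) (A ^+ m *m v) i j) @ \oo
      --> (Y *m v) i j.
Proof.
move=> Ac.
have cap0 : (kermx (A - 1) :&: (A - 1) = 0)%MS.
  apply/eqP; rewrite -submx0; apply/rV_subP => v; rewrite sub_capmx.
  case/andP=> /sub_kermxP vA /submxP[w vw].
  suff -> : v = 0 by rewrite sub0mx.
  apply: (ker_cap_image0 Ac) vw.
  by apply/eqP; rewrite -subr_eq0 -{2}[v]mulmx1 -mulmxBr vA.
have full : row_full (kermx (A - 1) + (A - 1))%MS.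
  by rewrite /row_full mxrank_disjoint_sum // mxrank_ker subnK ?rank_leq_row.
have /sub_addsmxP[[D W] /= dec] := submx_full (1%:M : 'M[R]_p) full.
pose Y := D *m kermx (A - 1).
have YA : Y *m A = Y.
  apply/eqP; rewrite -subr_eq0 -{2}[Y]mulmx1 -mulmxBr -mulmxA.
  by rewrite mulmx_ker mulmx0.
have {}dec : Y = 1 - W *m (A - 1) by apply/esym/(canLR (addrK _)); exact: dec.
have AY : A *m Y = Y.
  apply/eqP; rewrite -subr_eq0 -{2}[Y]mul1mx -mulmxBl; apply/eqP.
  (* [A *m Y - Y] is fixed by [A] and its rows lie in the image of [A - 1]. *)
  apply: (ker_cap_image0 Ac (w := 1 - (A - 1) *m W)).
    by rewrite -mulmxA YA.
  rewrite dec [LHS]mulmxBr [RHS]mulmxBl; congr (_ - _); last by rewrite mulmxA.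
  by rewrite [LHS]mulmx1 [RHS]mul1mx.
exists Y; split=> // q v i j.
have powE m : A ^+ m = Y + W *m (A ^+ m.+1 - A ^+ m).
  have YAm : Y *m A ^+ m = Y.
    by elim: m => [|m IH]; rewrite ?expr0 ?mulmx1 // exprSr mulmxA IH.
  rewrite -{1}YAm dec mulmxBl -mulmxA mulmxBl !mul1mx exprS.
  by rewrite subrK.
have addE (X Z : 'M[R]_(p, q)) : (X + Z) i j = X i j + Z i j by rewrite mxE.
have sumE N : \sum_(1 <= m < N.+1) (A ^+ m *m v) i j =
    (Y *m v) i j *+ N + (W *m ((A ^+ N.+1 - A) *m v)) i j.
  elim: N => [|N IH].
    by rewrite big_geq // mulr0n add0r expr1 subrr mul0mx mulmx0 mxE.
  have -> : W *m ((A ^+ N.+2 - A) *m v) =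
      W *m ((A ^+ N.+1 - A) *m v) + W *m (A ^+ N.+2 - A ^+ N.+1) *m v.
    by rewrite -mulmxA -mulmxDr -mulmxDl [X in _ = _ *m (X *m _)]addrC addrA subrK.
  rewrite big_nat_recr //= IH [A ^+ N.+1 *m v](_ : _ =
    Y *m v + W *m (A ^+ N.+2 - A ^+ N.+1) *m v); last by rewrite {1}powE mulmxDl.
  by rewrite !addE mulrSr addrACA.
have [B WB] : exists B, forall N, `|(W *m ((A ^+ N.+1 - A) *m v)) i j| <= B.
  apply: (mulmx_bounded _ _ (B := fun N => (A ^+ N.+1 - A) *m v)
    (c := \sum_k (c + c) * `|v k j|)) => N l.
  rewrite mxE (le_trans (ler_norm_sum _ _ _)) //; apply: ler_sum => k _.
  rewrite normrM ler_wpM2r // !mxE (le_trans (ler_normB _ _)) // lerD //.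
  by rewrite -[A]expr1.
rewrite -[X in _ --> X]addr0.
have lim : (fun N : nat => (Y *m v) i j +
    N%:R^-1 * (W *m ((A ^+ N.+1 - A) *m v)) i j) @ \oo --> (Y *m v) i j + 0.
  by apply: cvgD; [exact: cvg_cst | exact: cvg_mean0 WB].
apply: cvg_trans lim; apply: near_eq_cvg.
near=> N; rewrite sumE mulrDr -[(Y *m v) i j *+ N]mulr_natl mulKf //.
by rewrite pnatr_eq0 -lt0n; near: N; exact: nbhs_infty_gt.
Unshelve. all: by end_near.
Qed.

(** * Words of generators *)

Definition act (T : Type) (d : nat) (f : 'I_d -> T -> T) (w : seq 'I_d) (x : T) : T :=
  foldl (fun y c => f c y) x w.

Lemma act_cat (T : Type) (d : nat) (f : 'I_d -> T -> T) w1 w2 :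
  act f (w1 ++ w2) = act f w2 \o act f w1.
Proof. by apply/funext => x; rewrite /act foldl_cat. Qed.

(** The empty word is excluded: its map, the identity, need not belong to the
semigroup generated by the [f c]. *)
Definition word_maps (T : Type) (d : nat) (f : 'I_d -> T -> T) : set (T -> T) :=
  [set g | exists2 w, w <> [::] & g = act f w].

Lemma word_maps_closed (T : Type) (d : nat) (f : 'I_d -> T -> T) :
  comp_closed (word_maps f).
Proof.
move=> _ _ [v v0 ->] [w w0 ->]; exists (v ++ w); last by rewrite act_cat.
by case: v v0.
Qed.

Lemma gen_semigroup_words (R : realType) (n d : nat) (f : 'I_d -> 'I_n -> 'I_n)
    (C : 'I_d -> 'M[R]_n) :
  (forall c, C c = fun_mx R (f c)) ->
  gen_semigroup C = @fun_mx R n @` word_maps f.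
Proof.
move=> Cf; apply/seteqP; split=> [F|_ [_ [w w0 ->] <-]].
  elim=> [c|_ _ _ [g Sg <-] _ [h Sh <-]]; first by exists (f c) => //; exists [:: c].
  by exists (h \o g); [exact: word_maps_closed | rewrite fun_mxM].
elim/last_ind: w w0 => // w c IH _; rewrite -cats1 act_cat -fun_mxM.
have <- : C c = fun_mx R (act f [:: c]) by rewrite Cf.
case: w IH => [_|a w IH]; last first.
  by apply: gen_semigroup_mul; [exact: IH | exact: gen_semigroup_base].
suff -> : fun_mx R (act f [::]) *m C c = C c by exact: gen_semigroup_base.
by rewrite Cf fun_mxM.
Qed.

(** * Harmonic functions of two points *)

Definition harmonic2 (R : realType) (T : Type) (d : nat) (f : 'I_d -> T -> T)
    (h : T -> T -> R) : Prop :=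
  forall x y, h x y = d%:R^-1 * \sum_(c < d) h (f c x) (f c y).

(** An average of values at most [M] equals [M] only if all of them do; induct along
the word. *)
Lemma max_principle (R : realType) (T : Type) (d : nat) (f : 'I_d -> T -> T)
    (h : T -> T -> R) (M : R) (x y : T) :
  (0 < d)%N -> harmonic2 f h ->
  (forall w, h (act f w x) (act f w y) <= M) -> h x y = M ->
  forall w, h (act f w x) (act f w y) = M.
Proof.
move=> d0 hh hM hxy w; elim: w x y hM hxy => [//|c w IH] x y hM hxy.
apply: IH => [v|]; first exact: (hM (c :: v)).
have d1 : d%:R != 0 :> R by rewrite pnatr_eq0 -lt0n.
have s0 : \sum_(i < d) (M - h (f i x) (f i y)) = 0.
  by rewrite sumrB sumr_const card_ord -hxy -[h x y *+ d]mulr_natl hh mulVKf ?subrr.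
have /psumr_eq0P/(_ s0)/(_ c isT)/eqP : forall i : 'I_d, true -> 0 <= M - h (f i x) (f i y).
  by move=> i _; rewrite subr_ge0; exact: (hM [:: i]).
by rewrite subr_eq0 => /eqP.
Qed.

Lemma harmonic2_compl (R : realType) (T : Type) (d : nat) (f : 'I_d -> T -> T)
    (h : T -> T -> R) :
  (0 < d)%N -> harmonic2 f h -> harmonic2 f (fun x y => 1 - h x y).
Proof.
move=> d0 hh x y; rewrite sumrB sumr_const card_ord mulrBr -hh mulVf //.
by rewrite pnatr_eq0 -lt0n.
Qed.

(** * The vector u2 as a harmonic function *)

(** The sum has at most one term, and none when [x = y], so that vectors indexed by
pairs become functions of two points vanishing on the diagonal.  A row of
[pair_mx] that is 0 because the pair is collapsed then needs no separate case. *)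
Definition lift_pairs (R : realType) (n : nat) (v : 'cV[R]_#|pairs n|)
    (x y : 'I_n) : R :=
  \sum_(I | enum_val I == [set x; y]%SET) v I ord0.

Lemma lift_pairs_diag (R : realType) (n : nat) (v : 'cV[R]_#|pairs n|) x :
  lift_pairs v x x = 0.
Proof.
apply: big1 => I /eqP Ix; have := enum_valP I.
by rewrite Ix inE finset.setUid cards1.
Qed.

Lemma lift_pairsE (R : realType) (n : nat) (v : 'cV[R]_#|pairs n|) I x y :
  enum_val I = [set x; y]%SET -> lift_pairs v x y = v I ord0.
Proof.
move=> Ixy; rewrite /lift_pairs (big_pred1 I) // => J /=.
by rewrite -Ixy (inj_eq enum_val_inj).
Qed.

Lemma pair_endpoints (n : nat) (I : 'I_#|pairs n|) :
  exists x y, x != y /\ enum_val I = [set x; y]%SET.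
Proof. by have := enum_valP I; rewrite inE => /cards2P. Qed.

Lemma pair_index (n : nat) (x y : 'I_n) :
  x != y -> exists I : 'I_#|pairs n|, enum_val I = [set x; y]%SET.
Proof.
move=> xy; have pxy : [set x; y]%SET \in pairs n by rewrite inE cards2 xy.
by exists (enum_rank_in pxy [set x; y]%SET); rewrite enum_rankK_in.
Qed.

Lemma lift_pairs01 (R : realType) (n : nat) (v : 'cV[R]_#|pairs n|) x y :
  (forall I, 0 <= v I ord0 <= 1) -> 0 <= lift_pairs v x y <= 1.
Proof.
move=> v01; have [->|/pair_index[I Ixy]] := eqVneq x y.
  by rewrite lift_pairs_diag lexx ler01.
by rewrite (lift_pairsE _ Ixy).
Qed.

Lemma lift_pairs_A2 (R : realType) (n d : nat) (C : 'I_d -> 'M[R]_n)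
    (v : 'cV[R]_#|pairs n|) x y :
  lift_pairs (A2 C *m v) x y =
  d%:R^-1 * \sum_(c < d) lift_pairs v (fun_of_mx (C c) x) (fun_of_mx (C c) y).
Proof.
have [->|/pair_index[I Ixy]] := eqVneq x y.
  by rewrite lift_pairs_diag big1 ?mulr0 // => c _; rewrite lift_pairs_diag.
rewrite (lift_pairsE _ Ixy) /A2 -scalemxAl mxE mulmx_suml summxE; congr (_ * _).
apply: eq_bigr => c _; rewrite mxE /lift_pairs [RHS]big_mkcond /=.
apply: eq_bigr => J _; rewrite mxE Ixy imsetU1 imset_set1 eq_sym.
by case: ifP; rewrite ?mul1r ?mul0r.
Qed.

Lemma A2_pow01 (R : realType) (n d : nat) (C : 'I_d -> 'M[R]_n)
    (v : 'cV[R]_#|pairs n|) m :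
  (0 < d)%N -> (forall I, 0 <= v I ord0 <= 1) ->
  forall I, 0 <= (A2 C ^+ m *m v) I ord0 <= 1.
Proof.
move=> d0 v01; have dR : (0 : R) < d%:R by rewrite ltr0n.
elim: m => [|m IH] I; first by rewrite expr0 mul1mx.
have [x [y [_ Ixy]]] := pair_endpoints I.
rewrite exprS -mulmxA -(lift_pairsE _ Ixy) lift_pairs_A2.
have l01 c : 0 <= lift_pairs (A2 C ^+ m *m v) (fun_of_mx (C c) x) (fun_of_mx (C c) y) <= 1.
  exact: lift_pairs01.
rewrite mulr_ge0 ?invr_ge0 ?(ltW dR) //=; last first.
  by apply: sumr_ge0 => c _; case/andP: (l01 c).
rewrite ler_pdivrMl // mulr1 -[X in _ <= X%:R]card_ord -sumr_const.
by apply: ler_sum => c _; case/andP: (l01 c).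
Qed.

(** The vector [A2 C ^+ m *m const_mx 1] of row sums gives the probability that a
random word of length [m] does not collapse the pair. *)
Lemma A2_pow_uncollapsed (R : realType) (n d : nat) (C : 'I_d -> 'M[R]_n) m x y :
  (0 < d)%N ->
  (forall w, act (fun c => fun_of_mx (C c)) w x
          != act (fun c => fun_of_mx (C c)) w y) ->
  lift_pairs (A2 C ^+ m *m const_mx 1) x y = 1.
Proof.
move=> d0; elim: m x y => [|m IH] x y xy.
  have [I Ixy] := pair_index (xy [::]).
  by rewrite (lift_pairsE _ Ixy) expr0 mul1mx mxE.
rewrite exprS -mulmxA lift_pairs_A2 (eq_bigr (fun=> 1)); last first.
  by move=> c _; apply: IH => w; exact: (xy (c :: w)).
by rewrite sumr_const card_ord mulVf // pnatr_eq0 -lt0n.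
Qed.

(** The powers of [A2 C] have entries in [0, 1], so the mean ergodic theorem applies:
[Omega2 C] is a true limit, and [u2 C] is the limit of the mean row sums. *)
Lemma u2_ergodic (R : realType) (n d : nat) (C : 'I_d -> 'M[R]_n) :
  (0 < d)%N ->
  A2 C *m u2 C = u2 C /\ forall I,
    (fun N : nat => N%:R^-1 *
       \sum_(1 <= m < N.+1) (A2 C ^+ m *m const_mx 1 : 'cV_ _) I ord0) @ \oo
      --> u2 C I ord0.
Proof.
move=> d0; have Ab m I J : `|(A2 C ^+ m) I J| <= 1.
  have -> : (A2 C ^+ m) I J = (A2 C ^+ m *m delta_mx J (@ord0 0)) I ord0.
    by rewrite -colE mxE.
  have /andP[ge0 le1] : 0 <= (A2 C ^+ m *m delta_mx J (@ord0 0)) I ord0 <= 1.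
    by apply: A2_pow01 => // K; rewrite mxE ler0n lern1 leq_b1.
  by rewrite ger0_norm.
have [Y [AY Ylim]] := mean_ergodic Ab.
have OY : Omega2 C = Y.
  apply/matrixP => I J; rewrite mxE; apply: cvg_lim => //.
  have := Ylim _ 1%:M I J; rewrite mulmx1.
  by under eq_fun do under eq_bigr do rewrite mulmx1.
have uY : u2 C = Y *m const_mx 1.
  apply/matrixP => I J; rewrite !mxE OY; apply: eq_bigr => K _.
  by rewrite mxE mulr1.
by rewrite uY mulmxA AY; split=> // I; exact: Ylim.
Qed.

Lemma u2_harmonic (R : realType) (n d : nat) (C : 'I_d -> 'M[R]_n) :
  (0 < d)%N -> harmonic2 (fun c => fun_of_mx (C c)) (lift_pairs (u2 C)).
Proof. by move=> /(u2_ergodic C)[Au _] x y; rewrite -{1}Au lift_pairs_A2. Qed.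

Lemma u2_01 (R : realType) (n d : nat) (C : 'I_d -> 'M[R]_n) :
  (0 < d)%N -> forall I, 0 <= u2 C I ord0 <= 1.
Proof.
move=> d0 I; have [_ /(_ I) ulim] := u2_ergodic C d0.
have r01 m : 0 <= (A2 C ^+ m *m const_mx 1 : 'cV_ _) I ord0 <= 1.
  by apply: A2_pow01 => // J; rewrite mxE lexx ler01.
apply/andP; split.
  apply: (cvgr_to_ge ulim); apply: nearW => N.
  by rewrite mulr_ge0 ?invr_ge0 // sumr_ge0 // => m _; case/andP: (r01 m).
apply: (cvgr_to_le ulim); near=> N.
have N0 : (0 < N)%N by near: N; exact: nbhs_infty_gt.
rewrite ler_pdivrMl ?ltr0n // mulr1.
apply: (@le_trans _ _ (\sum_(1 <= m < N.+1) 1)).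
  by apply: ler_sum => m _; case/andP: (r01 m).
by rewrite sumr_const_nat subn1.
Unshelve. all: by end_near.
Qed.

Lemma u2_uncollapsed (R : realType) (n d : nat) (C : 'I_d -> 'M[R]_n) x y :
  (0 < d)%N ->
  (forall w, act (fun c => fun_of_mx (C c)) w x
          != act (fun c => fun_of_mx (C c)) w y) ->
  lift_pairs (u2 C) x y = 1.
Proof.
move=> d0 xy; have [I Ixy] := pair_index (xy [::]).
have [_ /(_ I) ulim] := u2_ergodic C d0.
rewrite (lift_pairsE _ Ixy); apply: (cvg_unique _ ulim) => //.
have cvg1 : (fun _ : nat => 1 : R) @ \oo --> (1 : R) by exact: cvg_cst.
apply: cvg_trans cvg1; apply: near_eq_cvg; near=> N.
have N0 : (0 < N)%N by near: N; exact: nbhs_infty_gt.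
rewrite (eq_bigr (fun=> 1)); last first.
  by move=> m _; rewrite -(lift_pairsE _ Ixy) A2_pow_uncollapsed.
by rewrite sumr_const_nat subn1 mulVf // pnatr_eq0 -lt0n.
Unshelve. all: by end_near.
Qed.

Theorem mainTheorem16 (R : realType) (n d : nat)
  (hn : (0 < n)%N) (hd : (0 < d)%N)
  (adj : 'M[nat]_n)
  (hout : forall i : 'I_n, (\sum_(j < n) adj i j)%N = d)
  (hirr : irreducible_mx (d%:R^-1 *: map_mx (fun m : nat => m%:R : R) adj))
  (haper : aperiodic_mx (d%:R^-1 *: map_mx (fun m : nat => m%:R : R) adj))
  (C : 'I_d -> 'M[R]_n)
  (hC : forall i : 'I_d, binary_stochastic (C i))
  (hsum : map_mx (fun m : nat => m%:R : R) adj = \sum_(i < d) C i) :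
  right_group (kernel_ideal (gen_semigroup C)) <->
  (forall I : 'I_#|pairs n|, u2 C I ord0 = 0 \/ u2 C I ord0 = 1).
Proof.
pose f c := fun_of_mx (C c); pose U := lift_pairs (u2 C).
pose S := word_maps f.
have S0 : S !=set0 by exists (act f [:: Ordinal hd]); exists [:: Ordinal hd].
have cS : comp_closed S := @word_maps_closed _ _ f.
have Uh : harmonic2 f U := u2_harmonic C hd.
have U01 x y : 0 <= U x y <= 1 by apply: lift_pairs01; exact: u2_01.
have U1 x y : (forall w, act f w x != act f w y) -> U x y = 1.
  exact: u2_uncollapsed.
rewrite (gen_semigroup_words (f := f)); last by move=> c; exact: binary_stochasticE.
rewrite kernel_ideal_fun // right_group_fun //.
split=> [ker I|u01 _ _ [[v v0 ->] mv] [[w w0 ->] mw] x y vxy].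
  have [x [y [xy Ixy]]] := pair_endpoints I; rewrite -(lift_pairsE _ Ixy) -/U.
  have [k mk] := ex_min_rank S0.
  (* Walking from a pair does not change whether [k] identifies its points. *)
  have kact a b w : k a = k b <-> k (act f w a) = k (act f w b).
    have [->//|/eqP w0] := eqVneq w [::].
    have mkw : min_rank S (k \o act f w) by apply: min_rank_compr => //; exists w.
    by split=> [/(ker _ _ mk mkw)|/(ker _ _ mkw mk)].
  have [kxy|kxy] := eqVneq (k x) (k y); [left|right]; last first.
    apply: U1 => w; apply: contraNneq kxy => E; apply/eqP.
    by apply/(kact _ _ w); rewrite E.
  pose P (z : 'I_n * 'I_n) := k z.1 == k z.2.
  have Pxy : P (x, y) by rewrite /P kxy.
  have [[a b] /= /eqP kab Umax] := @Order.TotalTheory.arg_maxP _ _ _ _ P (fun z => U z.1 z.2) Pxy.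
  have [[w w0 kw] _] := mk.
  (* The maximum of [U] inside a fibre is carried by the word of [k] to the diagonal. *)
  have Uab : U a b = 0.
    rewrite -(lift_pairs_diag (u2 C) (k a)) {2}kab kw -/(U _ _); apply/esym.
    apply: (max_principle hd Uh) => // v.
    apply: (Umax (act f v a, act f v b)); apply/eqP => /=.
    by case: (kact a b v) => /(_ kab).
  apply/eqP; rewrite eq_le; case/andP: (U01 x y) => -> _; rewrite andbT -Uab.
  exact: (Umax (x, y)).
apply/eqP; apply: contraT => wxy.
have xy : x != y by apply: contraNneq wxy => ->.
have [I Ixy] := pair_index xy.
have UI : U x y = u2 C I ord0 := lift_pairsE _ Ixy.
have Ule a b : U a b <= 1 by case/andP: (U01 a b).
have Uge a b : 1 - U a b <= 1 by rewrite gerBl; case/andP: (U01 a b).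
case: (u01 I); rewrite -UI => Uxy.
  (* [1 - U] attains its maximum 1, hence also at the images of x and y by [w],
     which no further word collapses. *)
  have := max_principle hd (harmonic2_compl hd Uh) (x := x) (y := y) (fun _ => Uge _ _) _ w.
  rewrite Uxy subr0 => /(_ erefl).
  rewrite U1 => [|t].
    by rewrite subrr => /esym/eqP; rewrite oner_eq0.
  apply: contra wxy => /eqP E; apply/eqP.
  have [t0|/eqP t0] := eqVneq t [::]; first by rewrite t0 in E.
  by apply: (min_rank_inj (S := S) (g := act f t)) => //; [split=> //; exists w | exists t].
(* The value 1 of [U] is carried by the word [v] to the diagonal. *)
have := max_principle hd Uh (fun _ => Ule _ _) Uxy v.
by rewrite vxy /U lift_pairs_diag => /esym/eqP; rewrite oner_eq0.
Qed.
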